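(* Let $\mathcal{S} = \langle a_1,\ldots,a_n\rangle \subset \mathbb{Z}^m$ be a pointed semigroup with Möbius function $\mu_{\mathcal{S}}:\mathbb{Z}^m\to\mathbb{Z}$ and Hilbert series $\mathcal{H}_{\mathcal{S}}(\mathbf{t})$, and let $c_1,\ldots,c_k$ be nonzero vectors in $\mathbb{Z}^m$. Write $$(1-\mathbf{t}^{c_1})\cdots(1-\mathbf{t}^{c_k})\,\mathcal{H}_{\mathcal{S}}(\mathbf{t}) = \sum_{b\in\mathbb{Z}^m} f_b\,\mathbf{t}^b \in \mathbb{Z}[[t_1,\ldots,t_m,t_1^{-1},\ldots,t_m^{-1}]].$$ Then, for all $x\in\mathbb{Z}^m$ with $x\notin\left\{\sum_{i\in A}c_i \ \middle|\ A\subset\{1,\ldots,k\}\right\}$, $$\sum_{b\in\mathbb{Z}^m} f_b\,\mu_{\mathcal{S}}(x-b)=0,$$ where for each such $x$ only finitely many summands are nonzero.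
   Context: $\mathbb{N}=\{0,1,2,\ldots\}$. For nonzero vectors $a_1,\ldots,a_n\in\mathbb{Z}^m$, $\mathcal{S}=\langle a_1,\ldots,a_n\rangle=\{x_1a_1+\cdots+x_na_n \mid x_1,\ldots,x_n\in\mathbb{N}\}$ is the semigroup they generate. It is pointed if $\mathcal{S}\cap(-\mathcal{S})=\{0\}$. In that case $x\leq_{\mathcal{S}}y \iff y-x\in\mathcal{S}$ defines a locally finite partial order on $\mathbb{Z}^m$. For $l\geq 0$ let $c_l(x,y)$ be the number of chains $x=z_0<_{\mathcal{S}}z_1<_{\mathcal{S}}\cdots<_{\mathcal{S}}z_l=y$ of length $l$ in $\mathbb{Z}^m$; the Möbius function of $\mathcal{S}$ is $\mu_{\mathcal{S}}(x):=\sum_{l\ge 0}(-1)^l c_l(0,x)$ for $x\in\mathbb{Z}^m$ (a finite sum). For $b=(b_1,\ldots,b_m)\in\mathbb{Z}^m$, $\mathbf{t}^b:=t_1^{b_1}\cdots t_m^{b_m}$. $\mathbb{Z}[[t_1,\ldots,t_m,t_1^{-1},\ldots,t_m^{-1}]]$ denotes the set of all formal sums $\sum_{b\in\mathbb{Z}^m}f_b\mathbf{t}^b$ with $f_b\in\mathbb{Z}$ (a module over the Laurent polynomial ring). The Hilbert series $\mathcal{H}_{\mathcal{S}}(\mathbf{t})$ of $\mathcal{S}$ is the multigraded Hilbert series of $k[x_1,\ldots,x_n]/I_{\mathcal{S}}$, where $k$ is a field, $\deg(x_i)=a_i$, and $I_{\mathcal{S}}$ is the kernel of the $k$-algebra map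 $k[x_1,\ldots,x_n]\to k[t_1^{\pm1},\ldots,t_m^{\pm1}]$, $x_i\mapsto\mathbf{t}^{a_i}$; equivalently, $\mathcal{H}_{\mathcal{S}}(\mathbf{t})=\sum_{b\in\mathcal{S}}\mathbf{t}^b$. *)

(* Defs.v *)
From mathcomp Require Export all_boot all_order all_algebra.
From mathcomp Require Export finmap boolp classical_sets functions cardinality.
From mathcomp Require Export fsbigop mpoly.

Set Implicit Arguments.
Unset Strict Implicit.
Unset Printing Implicit Defensive.

Import Order.TTheory GRing.Theory Num.Theory.

Local Open Scope classical_set_scope.
Local Open Scope ring_scope.

Section Semigroup.
Variables (m n : nat) (a : 'I_n -> 'rV[int]_m).

Definition semigroup : set 'rV[int]_m :=
  [set v | exists u : 'I_n -> nat, v = \sum_(i < n) a i *+ u i].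

Definition pointed : Prop :=
  semigroup `&` [set - v | v in semigroup] = [set 0].

Definition semi_le (x y : 'rV[int]_m) : Prop := semigroup (y - x).

Definition semi_lt : rel 'rV[int]_m := fun x y => `[< semi_le x y /\ x <> y >].

(* A chain x = z_0 < z_1 < ... < z_l = y is encoded by (z_1, ..., z_l), so it
   has length l.  [fset_set] is meaningful on finite sets only: the set below is
   finite when the a_i are nonzero and the semigroup is pointed. *)
Definition chains (l : nat) (x y : 'rV[int]_m) : set (l.-tuple 'rV[int]_m) :=
  [set z : l.-tuple 'rV[int]_m | path semi_lt x z /\ last x z = y].

Definition nb_chains (l : nat) (x y : 'rV[int]_m) : nat :=
  #|` fset_set (@chains l x y)|.

(* [\sum_(i \in A)] is the sum over the support, which is finite here under the
   same assumptions. *)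
Definition mobius (x : 'rV[int]_m) : int :=
  \sum_(l \in [set: nat]) (-1 : int) ^+ l * (nb_chains l 0 x)%:R.

End Semigroup.

Section ToricRing.
Variables (F : fieldType) (m n : nat) (a : 'I_n -> 'rV[int]_m).

(* The Laurent polynomial ring F[t_1^{+-1}, ..., t_m^{+-1}] is regarded as a
   subring of its fraction field F(t_1, ..., t_m). *)
Definition laurent_monomial (b : 'rV[int]_m) : {fraction {mpoly F[m]}} :=
  \prod_(j < m) tofrac ('X_j : {mpoly F[m]}) ^ (b 0 j).

Definition toric_map (p : {mpoly F[n]}) : {fraction {mpoly F[m]}} :=
  mmap (fun c : F => tofrac (c%:MP : {mpoly F[m]}))
       (fun i => laurent_monomial (a i)) p.

Definition toric_ideal : set {mpoly F[n]} := [set p | toric_map p = 0].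

Definition multidegree (u : 'X_{1..n}) : 'rV[int]_m := \sum_(i < n) a i *+ u i.

Definition multihomog (b : 'rV[int]_m) : set {mpoly F[n]} :=
  [set p | forall u, u \in msupp p -> multidegree u = b].

(* The classes of e_0, ..., e_(d-1) form a basis of the component of degree b
   of F[x_1, ..., x_n] / I_S. *)
Definition graded_basis (b : 'rV[int]_m) (d : nat) (e : 'I_d -> {mpoly F[n]}) :
    Prop :=
  (forall i, multihomog b (e i)) /\
  (forall p, multihomog b p ->
     exists! w : 'rV[F]_d, toric_ideal (p - \sum_(i < d) w 0 i *: e i)).

(* Dimension of that component ([xget 0] would return 0 if it were infinite). *)
Definition graded_dim (b : 'rV[int]_m) : nat :=
  xget 0%N [set d | exists e : 'I_d -> {mpoly F[n]}, graded_basis b e].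

End ToricRing.

(* The formal sum of f_b t^b over all b in Z^m is encoded by b |-> f_b. *)
Definition formal_series (m : nat) := 'rV[int]_m -> int.

Definition hilbert_series (F : fieldType) (m n : nat) (a : 'I_n -> 'rV[int]_m) :
    formal_series m :=
  fun b => (graded_dim F a b)%:Z.

Definition tmon (m : nat) (c : 'rV[int]_m) : formal_series m :=
  fun b => (b == c)%:R.

Definition one_minus_tmon (m : nat) (c : 'rV[int]_m) : formal_series m :=
  fun b => tmon 0 b - tmon c b.

(* Action of Laurent polynomials on formal series; only used for p of finite
   support, so that the sum is finite. *)
Definition laurent_mul (m : nat) (p f : formal_series m) : formal_series m :=
  fun b => \sum_(u \in [set: 'rV[int]_m]) p u * f (b - u).

Definition prod_one_minus (m k : nat) (c : 'I_k -> 'rV[int]_m) :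
    formal_series m :=
  \big[@laurent_mul m/tmon 0]_(i < k) one_minus_tmon (c i).

(* Main.v *)
(* The Hilbert series of S is the indicator zeta of S: on polynomials that are
   homogeneous of degree b, the toric map is (sum of the coefficients) * t^b.
   Splitting chains at their last step gives mu * zeta = delta_0.  Hence, with
   P = prod_i (1 - t^(c_i)) and f = P * zeta, one gets f * mu = P, which is
   supported on the subset sums of the c_i.  All sums are finite because the
   intervals of <=_S are. *)
Require Import Defs.

Set Implicit Arguments.
Unset Strict Implicit.
Unset Printing Implicit Defensive.

Import Order.TTheory GRing.Theory Num.Theory.

Local Open Scope classical_set_scope.
Local Open Scope ring_scope.

(** * Monotone subsequences and Dickson's lemma *)

Lemma nondecreasing_subseq (t : nat -> nat) :
  exists g : nat -> nat,
    {homo g : i j / (i < j)%N} /\ {homo (t \o g) : i j / (i <= j)%N}.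
Proof.
have tmin N : exists j, (N <= j)%N /\ forall i, (N <= i)%N -> (t j <= t i)%N.
  have exv : exists v, `[< exists2 j, (N <= j)%N & t j = v >].
    by exists (t N); apply/asboolP; exists N.
  case: (ex_minnP exv) => v /asboolP[j Nj tj] vmin; exists j; split=> // i Ni.
  by rewrite tj; apply: vmin; apply/asboolP; exists i.
have [h hP] := choice tmin.
(* [g] jumps from a minimizer of one tail to a minimizer of the tail strictly beyond it, so the
   values of [t] along [g] never decrease. *)
pose g := fix g i := if i is i'.+1 then h (g i').+1 else h 0%N.
have gS i : (g i < g i.+1)%N by exact: (hP _).1.
have gmin i j : (g i <= j)%N -> (t (g i) <= t j)%N.
  case: i => [|i] gij; apply: (hP _).2 => //.
  by apply: leq_trans gij; exact: gS.
have gincr : {homo g : i j / (i < j)%N}.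
  by apply: homo_ltn gS => i j k; exact: ltn_trans.
exists g; split=> // i j; rewrite leq_eqVlt => /predU1P[->//|/gincr/ltnW].
exact: gmin.
Qed.

(** Coordinates are treated one at a time: passing to a further subsequence keeps the earlier
    coordinates nondecreasing. *)
Lemma dickson_subseq (I : finType) (s : nat -> I -> nat) :
  exists g : nat -> nat, {homo g : i j / (i < j)%N} /\
    forall k : I, {homo (fun i => s (g i) k) : i j / (i <= j)%N}.
Proof.
suff [g [gincr gmono]] : exists g : nat -> nat, {homo g : i j / (i < j)%N} /\
    {in enum I, forall k, {homo (fun i => s (g i) k) : i j / (i <= j)%N}}.
  by exists g; split=> // k; apply: gmono; rewrite mem_enum.
elim: (enum I) => [|k r [g [gincr gmono]]]; first by exists id; split.
have [h [hincr hmono]] := nondecreasing_subseq (fun i => s (g i) k).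
exists (g \o h); split=> [i j ij|k']; first exact/gincr/hincr.
rewrite inE => /predU1P[-> i j|/gmono{}gmono i j ij]; first exact: hmono.
exact/gmono/(ltnW_homo hincr).
Qed.

(** * Finiteness of fibers and intervals in a pointed semigroup *)

Section PointedSemigroup.
Variables (m n : nat) (a : 'I_n -> 'rV[int]_m).
Hypotheses (a_neq0 : forall i, a i != 0) (S_pointed : pointed a).

Local Notation S := (semigroup a).
Local Notation deg u := (\sum_(i < n) a i *+ u i).

Lemma semigroup0 : S 0.
Proof. by exists (fun=> 0%N); rewrite big1. Qed.

Lemma semigroupD x y : S x -> S y -> S (x + y).
Proof.
move=> [u ->] [v ->]; exists (fun i => u i + v i)%N.
by rewrite -big_split /=; apply: eq_bigr => i _; rewrite mulrnDr.
Qed.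

(** If [u i > 0], lowering it by one expresses [- a i] as an element of [S], and pointedness then
    forces [a i = 0]. *)
Lemma deg_eq0 (u : 'I_n -> nat) : deg u = 0 -> forall i, u i = 0%N.
Proof.
move=> u0 i; apply/eqP/negPn/negP; rewrite -lt0n => ui.
have Sai : S (a i).
  exists (fun j => (j == i) : nat).
  rewrite (bigD1 i)//= eqxx mulr1n big1 ?addr0// => j /negPf->.
  by rewrite mulr0n.
have SNai : S (- a i).
  exists (fun j => u j - (j == i))%N.
  rewrite -[LHS]add0r -[X in X + _ = _]u0 (bigD1 i)//=.
  rewrite [RHS](bigD1 i)//= eqxx mulrnBr//.
  rewrite mulr1n addrAC; congr (_ + _).
  by apply: eq_bigr => j /negPf->; rewrite subn0.
have : (S `&` [set - v | v in S]) (a i).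
  by split=> //; exists (- a i) => //; rewrite opprK.
by rewrite S_pointed /= => ai0; have := a_neq0 i; rewrite ai0 eqxx.
Qed.

(* An unbounded fiber would contain, by Dickson's lemma, two comparable distinct
   vectors, whose difference is a nontrivial relation of degree 0. *)
Lemma fiber_bounded (x : 'rV[int]_m) :
  exists N, forall u : 'I_n -> nat, x = deg u -> (\sum_i u i <= N)%N.
Proof.
apply: contrapT => /forallNP unbounded.
have /choice[s sP] : forall N, exists u : 'I_n -> nat,
    x = deg u /\ (N < \sum_i u i)%N.
  move=> N; have /existsNP[u /not_implyP[xu /negP]] := unbounded N.
  by rewrite -ltnNge; exists u.
have [g [gincr gmono]] := dickson_subseq s.
have g_ge j : (j <= g j)%N.
  by elim: j => // j /leq_ltn_trans; apply; exact: gincr.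
(* Since [s N] has total above [N] and [j <= g j], this index gives [v] a larger total than [u]. *)
pose u := s (g 0%N); pose v := s (g (\sum_i u i)%N).
have uv i : (u i <= v i)%N by exact: gmono.
have : deg (fun i => v i - u i)%N = 0.
  under eq_bigr => i _ do rewrite mulrnBr//.
  by rewrite sumrB -(sP _).1 -(sP _).1 subrr.
move=> /deg_eq0 vu0.
have : (\sum_i v i <= \sum_i u i)%N.
  by apply: leq_sum => i _; rewrite -subn_eq0 vu0.
by rewrite leqNgt (leq_ltn_trans (g_ge _) (sP _).2).
Qed.

Definition interval (x : 'rV[int]_m) : set 'rV[int]_m :=
  [set y | S y /\ S (x - y)].

(** Exponents of [y] and of [x - y] add up to exponents of [x], so those of [y] are at most the
    fiber bound [N]. *)
Lemma finite_interval x : finite_set (interval x).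
Proof.
have [N NP] := fiber_bounded x.
apply: (@sub_finite_set _ _
    [set deg w | w in [set: {ffun 'I_n -> 'I_N.+1}]]); last first.
  exact/finite_image/finite_finset.
move=> y [[u yu] [v xyv]].
have uN i : (u i < N.+1)%N.
  have /NP : x = deg (fun i => u i + v i)%N.
    under eq_bigr => j _ do rewrite mulrnDr.
    by rewrite big_split -yu -xyv /= addrC subrK.
  by rewrite ltnS; apply: leq_trans; rewrite (bigD1 i)//= -addnA leq_addr.
exists [ffun i => Ordinal (uN i)] => //.
by rewrite yu; apply: eq_bigr => i _; rewrite ffunE.
Qed.

(** * Chains and their recursion on the last step *)

Lemma semi_ltP x y : reflect (semi_le a x y /\ x <> y) (semi_lt a x y).
Proof. exact: asboolP. Qed.

(** Every strict step uses at least one generator. With [fiber_bounded] this bounds the length of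
    all chains between two given points. *)
Lemma path_size x (z : seq 'rV[int]_m) : path (semi_lt a) x z ->
  exists u : 'I_n -> nat, last x z - x = deg u /\ (size z <= \sum_i u i)%N.
Proof.
elim: z x => [|y z IHz] x /=.
  by exists (fun=> 0%N); rewrite subrr big1.
move=> /andP[/semi_ltP[[v yxv] xy] /IHz[u [zyu sz]]].
exists (fun i => v i + u i)%N; split.
  under eq_bigr do rewrite mulrnDr.
  by rewrite big_split /= -yxv -zyu addrC subrKA.
rewrite big_split /= -add1n leq_add// lt0n; apply/eqP => v0; apply: xy.
apply/esym/eqP; rewrite -subr_eq0 yxv big1// => i _.
by move/eqP: v0; rewrite sum_nat_eq0 => /forallP/(_ i)/eqP->.
Qed.

Lemma chains_semigroup l x : chains a (l := l) 0 x !=set0 -> S x.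
Proof.
by move=> [z [/path_size[u [+ _]] zx]]; rewrite zx subr0 => ->; exists u.
Qed.

Lemma chains_rcons l x :
  chains a (l := l.+1) 0 x =
  \bigcup_(y in interval x `\ x)
     [set rcons_tuple z x | z in chains a (l := l) 0 y].
Proof.
apply/seteqP; split=> [[s ss] [/= ps sx]|_ [y [[_ Sxy] yx] [z [pz zy] <-]]].
  case/lastP: s => [//|s y] in ss ps sx *.
  have sl : size s == l by rewrite size_rcons in ss.
  rewrite last_rcons in sx; rewrite {y}sx in ss ps *.
  move: ps; rewrite rcons_path => /andP[ps /semi_ltP[Sx yx]].
  (* The element before [x] is [last 0 s]; for [l = 0] it is the starting point 0. *)
  exists (last 0 s); last by exists (Tuple sl) => //; apply: val_inj.
  split=> //; split=> //.
  by apply: (@chains_semigroup l); exists (Tuple sl).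
split; last by rewrite last_rcons.
by rewrite rcons_path pz zy; apply/semi_ltP.
Qed.

Lemma finite_chains l x : finite_set (chains a (l := l) 0 x).
Proof.
elim: l x => [|l IHl] x.
    by apply: (@sub_finite_set _ _ [set [tuple]]) => // z _; exact: (tuple0 z).
rewrite chains_rcons; apply: bigcup_finite => [|y _]; last exact: finite_image.
exact/finite_setD/finite_interval.
Qed.

Lemma nb_chains0 x : nb_chains a 0 0 x = (x == 0).
Proof.
rewrite /nb_chains; have [->|x0] := eqVneq x 0.
  rewrite (_ : chains _ _ _ = [set [tuple]]) ?fset_set1 ?cardfs1//.
  by apply/seteqP; split=> z => [_|->]; [exact: (tuple0 z) | split].
rewrite (_ : chains _ _ _ = set0) ?fset_set0 ?cardfs0//.
apply/seteqP; split=> // z; rewrite (tuple0 z) => -[_ /= x0'].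
by rewrite x0' eqxx in x0.
Qed.

Lemma nb_chainsS l x : nb_chains a l.+1 0 x =
  (\sum_(y <- fset_set (interval x) | y != x) nb_chains a l 0 y)%N.
Proof.
pose ch y : seq (l.-tuple 'rV[int]_m) := fset_set (chains a (l := l) 0 y).
have mem_ch y z : (z \in ch y) = (z \in chains a (l := l) 0 y).
  by rewrite in_fset_set//; exact: finite_chains.
pose r := [seq y <- fset_set (interval x) | y != x].
have : perm_eq (fset_set (chains a (l := l.+1) 0 x))
    [seq rcons_tuple z x | y <- r, z <- ch y].
  apply: uniq_perm => //.
    apply: allpairs_uniq_dep => [|y _|].
    - exact/filter_uniq/fset_uniq.
    - exact: fset_uniq.
    (* The endpoint of [z] gives back [y], so different pairs yield different chains. *)
    - have ch_last p : p \in [seq existT (fun=> l.-tuple 'rV[int]_m) y z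
          | y <- r, z <- ch y] ->
          last (0 : 'rV[int]_m) (tagged p) = tag p.
        by move=> /allpairsPdep[y [z [_ + ->]]]; rewrite mem_ch => /set_mem[].
      move=> [y z] [y' z'] /ch_last/= <- /ch_last/= <- /(congr1 val)/=.
      by move=> /rcons_inj[/val_inj->].
  move=> z; rewrite in_fset_set; last exact: finite_chains.
  rewrite chains_rcons; apply/idP/allpairsPdep => [|[y [t]]].
    rewrite inE => -[y [Iy yx] [t cht <-]]; exists y, t; split=> //.
      rewrite mem_filter in_fset_set; last exact: finite_interval.
      by apply/andP; split; [exact/eqP|exact: mem_set].
    by rewrite mem_ch inE.
  rewrite mem_filter in_fset_set; last exact: finite_interval.
  rewrite mem_ch !inE => -[/andP[/eqP yx Iy] cht ->].
  by exists y; [split=> //; exact: set_mem|exists t].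
move=> /perm_size; rewrite /nb_chains => ->.
by rewrite size_allpairs_dep sumnE big_map big_filter.
Qed.

(** * The Möbius function as inverse of the zeta function *)

Lemma nb_chains_eq0 l x :
  (forall z, ~ chains a (l := l) 0 x z) -> nb_chains a l 0 x = 0%N.
Proof.
move=> nch; rewrite /nb_chains (_ : chains _ _ _ = set0) ?fset_set0 ?cardfs0//.
by apply/seteqP; split=> // z /nch.
Qed.

Lemma mobius_out x : ~ S x -> mobius a x = 0.
Proof.
move=> NSx; apply: fsbig1 => l _; rewrite nb_chains_eq0 ?mulr0// => z xz.
by apply: NSx; apply: (@chains_semigroup l); exists z.
Qed.

(** Chains longer than every exponent total of [x] do not exist. Any bound [N] is allowed, so that
    one [N] can serve a whole interval. *)
Lemma mobius_ord x N :
  (forall u : 'I_n -> nat, x = deg u -> \sum_i u i <= N)%N ->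
  mobius a x = \sum_(l < N.+1) (-1) ^+ l * (nb_chains a l 0 x)%:R.
Proof.
move=> xN.
rewrite (fsbig_ord _ _ (fun l => (-1) ^+ l * (nb_chains a l 0 x)%:R)).
apply/esym/fsbig_widen => // l [_ /= /negP]; rewrite -leqNgt => Nl.
rewrite nb_chains_eq0 ?mulr0// => z [/path_size[u [+ lu]] zx].
rewrite zx subr0 => /xN uN; rewrite size_tuple in lu.
by have := leq_trans (leq_trans Nl lu) uN; rewrite ltnn.
Qed.

Lemma sum_mobius_interval x :
  \sum_(y <- fset_set (interval x)) mobius a y = (x == 0)%:R.
Proof.
have Ifin := finite_interval x.
have [Sx|NSx] := pselect (S x); last first.
  (* The interval is empty here: [y + (x - y)] would put [x] in [S]. *)
  rewrite big_seq big1 => [|y]; last first.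
    rewrite in_fset_set// inE => -[Sy Sxy]; case: NSx.
    by rewrite -(subrK y x); exact: semigroupD.
  by case: eqP NSx => // -> []; exact: semigroup0.
have [N xN] := fiber_bounded x.
have xI : x \in fset_set (interval x).
  by rewrite in_fset_set// inE; split=> //; rewrite subrr; exact: semigroup0.
(* With cutoff [N.+1], splitting off [l = 0] leaves the lengths [l.+1] with [l <= N], which match
   the cutoff [N] used for the points [y != x]. *)
rewrite (bigD1_seq x) ?fset_uniq//= (@mobius_ord x N.+1); last first.
  by move=> u /xN/leqW.
rewrite big_ord_recl nb_chains0 mul1r -[RHS]addr0 -addrA; congr (_ + _).
(* Chains of length [l.+1] to [x] correspond to chains of length [l] to the points [y != x] of the
   interval, with opposite sign, so the two sums cancel. *)
transitivity (\sum_(l < N.+1) ((-1) ^+ l.+1 * (nb_chains a l.+1 0 x)%:R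
    + (-1) ^+ l * (nb_chains a l.+1 0 x)%:R) : int); last first.
  by rewrite big1// => l _; rewrite exprS mulN1r mulNr addNr.
rewrite big_split; congr (_ + _).
under [RHS]eq_bigr => l _ do rewrite nb_chainsS natr_sum mulr_sumr.
rewrite exchange_big big_seq_cond [RHS]big_seq_cond /=.
apply: eq_bigr => y /andP[+ _]; rewrite in_fset_set// inE => -[Sy [v xyv]].
(* Adding exponents of [x - y] shows that the bound [N] for [x] also holds for [y]. *)
apply: mobius_ord => u yu.
have /xN : x = deg (fun i => u i + v i)%N.
  under eq_bigr do rewrite mulrnDr.
  by rewrite big_split -yu -xyv /= addrC subrK.
by apply: leq_trans; rewrite big_split leq_addr.
Qed.

(** A summand vanishes unless [y] and [x - y] both lie in [S], which reduces the sum to the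
    interval. *)
Lemma mobius_zeta x :
  \sum_(y \in [set: 'rV[int]_m]) (x - y \in S)%:R * mobius a y = (x == 0)%:R.
Proof.
rewrite -sum_mobius_interval (@fsbigTE _ _ _ _ (fset_set (interval x))).
  rewrite big_seq [RHS]big_seq; apply: eq_bigr => y.
  rewrite in_fset_set; last exact: finite_interval.
  by rewrite inE => -[_ Sxy]; rewrite mem_set// mul1r.
move=> y; rewrite in_fset_set; last exact: finite_interval.
move/negP; rewrite inE => nI.
have [Sy|/mobius_out->] := pselect (S y); last by rewrite mulr0.
by rewrite memNset ?mul0r// => Sxy; apply: nI.
Qed.

End PointedSemigroup.

(** * The Hilbert series as indicator of the semigroup *)

Section HilbertSeries.
Variables (F : fieldType) (m n : nat) (a : 'I_n -> 'rV[int]_m).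

Local Notation L := (@laurent_monomial F m).
Local Notation ones := (fun=> 1 : F).

Lemma mpoly_var_frac_neq0 (j : 'I_m) : tofrac ('X_j : {mpoly F[m]}) != 0.
Proof. by rewrite tofrac_eq0 -msupp_eq0 msuppX. Qed.

Lemma laurent_monomial_neq0 b : L b != 0.
Proof.
by apply/prodf_neq0 => j _; rewrite expfz_neq0// mpoly_var_frac_neq0.
Qed.

Lemma laurent_monomialD b b' : L (b + b') = L b * L b'.
Proof.
rewrite -big_split; apply: eq_bigr => j _.
by rewrite mxE expfzDr// mpoly_var_frac_neq0.
Qed.

Lemma laurent_monomial0 : L 0 = 1.
Proof. by rewrite /L big1// => j _; rewrite mxE. Qed.

Lemma laurent_monomial_multidegree (u : 'X_{1..n}) :
  L (multidegree a u) = mmap1 (fun i => L (a i)) u.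
Proof.
rewrite /multidegree (big_morph _ laurent_monomialD laurent_monomial0).
apply: eq_bigr => i _; elim: (u i : nat) => [|k IHk].
  by rewrite mulr0n laurent_monomial0.
by rewrite mulrS laurent_monomialD IHk exprS.
Qed.

(** All monomials of [p] have the same image, and evaluation at the all-ones point is the sum of the
    coefficients. *)
Lemma toric_map_multihomog b (p : {mpoly F[n]}) : multihomog a b p ->
  toric_map a p = tofrac (p.@[ones])%:MP * L b.
Proof.
move=> pb; rewrite mevalE !rmorph_sum mulr_suml [LHS]big_seq [RHS]big_seq.
apply: eq_bigr => u /pb <-; rewrite laurent_monomial_multidegree.
by rewrite big1 ?mulr1// => i _; rewrite expr1n.
Qed.

Lemma toric_ideal_multihomog b (p : {mpoly F[n]}) : multihomog a b p ->
  toric_ideal a p <-> p.@[ones] = 0.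
Proof.
move=> /toric_map_multihomog pb; rewrite /toric_ideal /= pb.
split=> [/eqP|->]; last by rewrite mpolyC0 tofrac0 mul0r.
rewrite mulf_eq0 (negPf (laurent_monomial_neq0 b)) orbF tofrac_eq0.
by rewrite mpolyC_eq0 => /eqP.
Qed.

Lemma multihomogZ b (k : F) p : multihomog a b p -> multihomog a b (k *: p).
Proof. by move=> pb u /msuppZ_le/pb. Qed.

Lemma multihomog0 b : multihomog a b (0 : {mpoly F[n]}).
Proof. by move=> u; rewrite msupp0. Qed.

Lemma multihomogD b (p q : {mpoly F[n]}) :
  multihomog a b p -> multihomog a b q -> multihomog a b (p + q).
Proof. by move=> pb qb u /msuppD_le; rewrite mem_cat => /orP[/pb|/qb]. Qed.

(** Evaluation at [ones] embeds the component of degree [b] into [F], so a relation modulo the ideal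
    becomes one linear equation. *)
Lemma toric_ideal_comb b d (e : 'I_d -> {mpoly F[n]}) p (w : 'rV[F]_d) :
  (forall i, multihomog a b (e i)) -> multihomog a b p ->
  toric_ideal a (p - \sum_(i < d) w 0 i *: e i) <->
  p.@[ones] = \sum_(i < d) w 0 i * (e i).@[ones].
Proof.
move=> eb pb; rewrite (@toric_ideal_multihomog b).
  rewrite mevalB (raddf_sum (meval ones)) /=; under eq_bigr do rewrite mevalZ.
  by split=> [/subr0_eq|->]; rewrite ?subrr.
apply: multihomogD => //; rewrite -scaleN1r; apply: multihomogZ.
by elim/big_ind: _ => [|q r|i _];
  [exact: multihomog0|exact: multihomogD|exact: multihomogZ].
Qed.

Lemma graded_dim_semigroup b : semigroup a b -> graded_dim F a b = 1%N.
Proof.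
move=> [v bv]; pose X : {mpoly F[n]} := 'X_[[multinom v i | i < n]].
have Xb : multihomog a b X.
  move=> u; rewrite msuppX inE => /eqP->; rewrite bv.
  by apply: eq_bigr => i _; rewrite mnmE.
have X1 : X.@[ones] = 1.
  by rewrite mevalX big1// => i _; rewrite expr1n.
apply: xget_unique => [|d [e [eb basis]]].
  exists (fun=> X); split=> // p pb; exists (const_mx p.@[ones]); split.
    by apply/(@toric_ideal_comb b) => //; rewrite big_ord1 mxE X1 mulr1.
  move=> w /(@toric_ideal_comb b) -> //; rewrite big_ord1 X1 mulr1.
  by apply/rowP => i; rewrite mxE [i]ord1.
have [wX [/(@toric_ideal_comb b _ _ _ _ eb Xb) wX1 _]] := basis X Xb.
(* Row [i] holds the coordinates of [e i] in the basis [e]; they are also [(e i).@[ones]] times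
   those of [X]. Hence the identity of size [d] has rank at most 1. *)
have idE : 1%:M = (\col_i (e i).@[ones]) *m wX.
  apply/row_matrixP => i; rewrite row_mul.
  have [w [_ wU]] := basis (e i) (eb i).
  transitivity w; first apply/esym.
    apply: wU; apply/(@toric_ideal_comb b) => //.
    rewrite (bigD1 i)//= big1 => [|j ji].
      by rewrite !mxE eqxx mul1r addr0.
    by rewrite !mxE eq_sym (negPf ji) mul0r.
  apply: wU; apply/(@toric_ideal_comb b) => //.
  under eq_bigr do rewrite mxE big_ord1 !mxE -mulrA.
  by rewrite -mulr_sumr -wX1 X1 mulr1.
have : (d <= 1)%N by rewrite -(mxrank1 F d) idE mulmx_max_rank.
(* The case [d = 0] fails because [X] evaluates to 1, not to an empty sum. *)
rewrite leq_eqVlt ltnS leqn0 => /predU1P[//|/eqP d0].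
move: wX1; rewrite X1 big1 => [/eqP|i]; first by rewrite oner_eq0.
by have := ltn_ord i; rewrite [X in (_ < X)%N]d0.
Qed.

Lemma graded_dim_out b : ~ semigroup a b -> graded_dim F a b = 0%N.
Proof.
move=> Nb; have b0 (p : {mpoly F[n]}) : multihomog a b p -> p = 0.
  move=> pb; apply/eqP; rewrite -msupp_eq0; case E: (msupp p) => [//|u s].
  by case: Nb; exists u; rewrite -(pb u)// E mem_head.
apply: xget_unique => [|d [e [eb basis]]].
  exists (fun=> 0); split=> [_|p pb]; first exact: multihomog0.
  exists 0; split=> [|w _]; last by rewrite thinmx0.
  apply/(@toric_ideal_comb b) => //; first by move=> _; exact: multihomog0.
  by rewrite big_ord0 (b0 p pb) meval0.
have [w [_ wU]] := basis 0 (multihomog0 b).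
(* All [e i] vanish, so every row represents 0; uniqueness would identify the rows 0 and 1 if [d]
   were positive. *)
have all_w w' : w = w'.
  apply: wU; apply/(@toric_ideal_comb b) => //; first exact: multihomog0.
  by rewrite meval0 big1// => i _; rewrite (b0 (e i))// meval0 mulr0.
have := all_w 0; rewrite (all_w (const_mx 1)).
case: d {e eb basis w wU all_w} => //.
by move=> d /rowP/(_ 0); rewrite !mxE => /eqP; rewrite oner_eq0.
Qed.

Lemma hilbert_seriesE b : hilbert_series F a b = (b \in semigroup a)%:R.
Proof.
rewrite /hilbert_series; have [Sb|NSb] := pselect (semigroup a b).
  by rewrite graded_dim_semigroup// mem_set.
by rewrite graded_dim_out// memNset.
Qed.

End HilbertSeries.

(** * Support of the product and the vanishing sum *)

Lemma laurent_mul_neq0 m (p g : formal_series m) b : laurent_mul p g b != 0 ->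
  exists u, p u != 0 /\ g (b - u) != 0.
Proof.
apply: contra_neqP => /forallNP pg0; apply: fsbig1 => u _.
have [->|pu] := eqVneq (p u) 0; first by rewrite mul0r.
have [->|gu] := eqVneq (g (b - u)) 0; first by rewrite mulr0.
by case: (pg0 u).
Qed.

(** In the expanded product each factor contributes the exponent 0 or [c i]; [A] collects the
    indices of the second kind. *)
Lemma prod_one_minus_neq0 m k (c : 'I_k -> 'rV[int]_m) x :
  prod_one_minus c x != 0 -> exists A : {set 'I_k}, x = \sum_(i in A) c i.
Proof.
rewrite /prod_one_minus.
(* Keeping [A] inside the duplicate-free list [r] guarantees that the next index is not yet in
   [A]. *)
suff: forall r, uniq r ->
    (\big[@laurent_mul m/tmon 0]_(i <- r) one_minus_tmon (c i)) x != 0 ->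
    exists2 A : {set 'I_k}, A \subset r & x = \sum_(i in A) c i.
  by move=> /(_ _ (index_enum_uniq _))/[apply] -[A _ ->]; exists A.
move=> r; elim: r x => [|i r IHr] x /=.
  rewrite big_nil /tmon; case: (eqVneq x 0) => [-> _|_ //].
  exists finset.set0; last by rewrite finset.big_set0.
  by apply/fintype.subsetP => j; rewrite finset.in_set0.
rewrite big_cons => /andP[ir ur] /laurent_mul_neq0[u [u0 /(IHr _ ur)[A Ar xu]]].
have {u0} : u = 0 \/ u = c i.
  move: u0; rewrite /one_minus_tmon /tmon.
  by case: (eqVneq u 0) => [|_]; [left|case: (eqVneq u (c i)); [right|]].
have x_eq : x = u + \sum_(j in A) c j by rewrite -xu addrC subrK.
case=> u_eq.
  exists A; last by rewrite x_eq u_eq add0r.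
  by apply/fintype.subsetP => j /(fintype.subsetP Ar) jr; rewrite inE jr orbT.
exists (i |: A)%SET.
  apply/fintype.subsetP => j; rewrite !inE.
  move=> /predU1P[->|/(fintype.subsetP Ar)->].
    by rewrite eqxx.
  by rewrite orbT.
by rewrite finset.big_setU1 -?u_eq//; apply: contra ir => /(fintype.subsetP Ar).
Qed.

Theorem theorem3p1 (F : fieldType) (m n k : nat)
    (a : 'I_n -> 'rV[int]_m) (ha : forall i, a i != 0) (hS : pointed a)
    (c : 'I_k -> 'rV[int]_m) (hc : forall i, c i != 0)
    (f : formal_series m)
    (hf : f = laurent_mul (prod_one_minus c) (hilbert_series F a))
    (x : 'rV[int]_m)
    (hx : ~ exists A : {set 'I_k}, x = \sum_(i in A) c i) :
  finite_set [set b : 'rV[int]_m | f b * mobius a (x - b) != 0] /\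
  \sum_(b \in [set: 'rV[int]_m]) f b * mobius a (x - b) = 0.
Proof.
pose p := prod_one_minus c; pose S := semigroup a.
pose U := range (fun A : {set 'I_k} => \sum_(i in A) c i).
pose V := fset_set U.
have Ufin : finite_set U by exact/finite_image/finite_finset.
have pU u : u \notin V -> p u = 0.
  rewrite in_fset_set// => /negP uU; apply/eqP/negPn/negP.
  by move=> /prod_one_minus_neq0[A uA]; apply/uU/mem_set; exists A.
have fE b : f b = \sum_(u <- V) p u * (b - u \in S)%:R.
  rewrite hf /laurent_mul (@fsbigTE _ _ _ _ V) => [|u /pU]; last first.
    by rewrite -/p => ->; rewrite mul0r.
  by apply: eq_bigr => u _; rewrite hilbert_seriesE.
(* Here [y] stands for [x - b]: [B] contains every [b] such that [b - u] and [x - b] lie in [S] for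
   some subset sum [u]. *)
pose B := \bigcup_(u in U) [set x - y | y in interval a (x - u)].
have Bfin : finite_set B.
  apply: bigcup_finite => // u _; exact/finite_image/finite_interval.
(* Vanishing for each [u] separately allows each inner sum to be extended back from [B] to all of
   Z^m after the exchange of sums. *)
have BP u b : u \in V -> b \notin fset_set B ->
    (b - u \in S)%:R * mobius a (x - b) = 0 :> int.
  rewrite !in_fset_set// inE => Uu /negP bB.
  have [Sxb|/mobius_out->] := pselect (S (x - b)); last by rewrite mulr0.
  rewrite memNset ?mul0r// => Sbu; apply/bB/mem_set; exists u => //.
  exists (x - b); last by rewrite subKr.
  by split=> //; rewrite opprB addrC subrKA.
have fB b : b \notin fset_set B -> f b * mobius a (x - b) = 0.
  move=> bB; rewrite fE mulr_suml big_seq big1// => u uV.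
  by rewrite -mulrA BP// mulr0.
split.
  apply: (sub_finite_set _ Bfin) => b /=; apply: contra_neqP => bB; apply: fB.
  by rewrite in_fset_set// memNset.
rewrite (fsbigTE _ _ fB); under eq_bigr do rewrite fE mulr_suml.
rewrite exchange_big big_seq big1//= => u uV.
under eq_bigr do rewrite -mulrA.
rewrite -mulr_sumr -(fsbigTE _ _ (fun b => @BP u b uV)).
(* With [b = x - y] the inner sum becomes [mobius_zeta] at [x - u], nonzero only for [x = u], which
   [hx] excludes. *)
rewrite (reindex_fsbigT (fun y => x - y)); last first.
  by exists (fun y => x - y) => y; rewrite subKr.
under eq_fsbigr do rewrite subKr addrAC.
rewrite mobius_zeta//; case: eqP => [/subr0_eq xu|]; last by rewrite mulr0.
by case: hx; move: uV; rewrite in_fset_set// -xu inE => -[A _ <-]; exists A.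
Qed.
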